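(* Let $M=M_1\times_fM_2$ be a Lyra twisted warped product with scale $\varphi$, $k=\ln f$, $\sigma=\ln\varphi$. Assume $n_2=\dim M_2>1$ and that the Lyra scale is base-dependent, i.e. $\sigma=\sigma_1$ for some $\sigma_1\in C^\infty(M_1)$. Then every Lyra almost Ricci--Bourguignon soliton $(g_L,Z,\lambda,\rho)$ on $M$ with projectable potential field $Z=Z_1+Z_2$ satisfies $$XU(k)=0$$ for all horizontal lifts $X$ and vertical lifts $U$. Consequently, on every connected product neighborhood $W_1\times W_2\subset M_1\times M_2$ there are functions $k_1$ on $W_1$ and $k_2$ on $W_2$ with $k=k_1+k_2$, and hence $f=f_1f_2$ with $f_1=e^{k_1}$ depending only on $W_1$ and $f_2=e^{k_2}$ depending only on $W_2$.
   Context: Lyra twisted warped product: $(M_1,g_1),(M_2,g_2)$ are smooth pseudo-Riemannian manifolds of positive dimensions $n_1,n_2$, $n=n_1+n_2$; $f,\varphi:M_1\times M_2\to(0,\infty)$ are smooth; $M=M_1\times M_2$ carries $g=g_1\oplus f^2g_2$ and $g_L=\varphi^2g=e^{2\sigma}g$. $\operatorname{Ric}^L,R^L$ are the Ricci tensor and scalar curvature of $g_L$. A Lyra almost Ricci--Bourguignon soliton is $(g_L,Z,\lambda,\rho)$ with $Z$ a vector field on $M$, $\lambda\in C^\infty(M)$, $\rho\in\mathbb R$, satisfying $\operatorname{Ric}^L+\frac12\mathcal L_Zg_L=(\lambda+\rho R^L)g_L$. Horizontal (vertical) lifts are canonical lifts to $M$ of vector fields on $M_1$ ($M_2$); $Z$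 is projectable if $Z=Z_1+Z_2$ with $Z_1$ a horizontal lift and $Z_2$ a vertical lift. $XU(k)=X(U(k))$. *)

(* Defs.v *)
From HB Require Import structures.
From mathcomp Require Import all_boot all_order all_algebra.
From mathcomp Require Import all_classical all_reals all_analysis.

Set Implicit Arguments.
Unset Strict Implicit.
Unset Printing Implicit Defensive.

Import Order.TTheory GRing.Theory Num.Theory.
Import numFieldNormedType.Exports.

Local Open Scope classical_set_scope.
Local Open Scope ring_scope.

Section SmoothCalculus.
Variables (R : realType) (n : nat).
Implicit Types (A : set 'rV[R]_n) (f : 'rV[R]_n -> R).

Definition partial (a : 'I_n) f : 'rV[R]_n -> R := 'D_(delta_mx 0 a) f.

(* Intended for open A: all iterated partial derivatives of order at most k
   exist and are continuous at every point of A. *)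
Fixpoint Ck_on (k : nat) A f : Prop :=
  (forall x, A x -> {for x, continuous f}) /\
  (if k is k'.+1 then
     forall a : 'I_n,
       (forall x, A x -> derivable f x (delta_mx 0 a)) /\
       Ck_on k' A (partial a f)
   else True).

Definition Cinf_on A f : Prop := forall k, Ck_on k A f.

End SmoothCalculus.

(* A space with an indexed atlas. [minv i] is the inverse of the chart
   [mchart i] and is meaningful only on the image of [mdom i]; [mat p] is some
   chart around p. The axioms are in [smooth_manifold] below, so that the
   geometric notions can be stated on the bare data. *)
Record charted (R : realType) (n : nat) := Charted {
  mspace :> topologicalType;
  mindex : Type;
  mdom : mindex -> set mspace;
  mchart : mindex -> mspace -> 'rV[R]_n;
  minv : mindex -> 'rV[R]_n -> mspace;
  mat : mspace -> mindex }.

Arguments mindex {R n} _.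
Arguments mdom {R n} _ _.
Arguments mchart {R n} _ _.
Arguments minv {R n} _ _.
Arguments mat {R n} _ _.

Section Manifold.
Variables (R : realType) (n : nat) (M : charted R n).

Definition mimage (i : mindex M) : set 'rV[R]_n := mchart M i @` mdom M i.

Definition moverlap (i j : mindex M) : set 'rV[R]_n :=
  mimage i `&` minv M i @^-1` mdom M j.

Definition transition (i j : mindex M) : 'rV[R]_n -> 'rV[R]_n :=
  mchart M j \o minv M i.

Record smooth_manifold : Prop := SmoothManifold {
  mdom_open : forall i, open (mdom M i);
  mimage_open : forall i, open (mimage i);
  mchartK : forall i p, mdom M i p -> minv M i (mchart M i p) = p;
  mchart_continuous :
    forall i p, mdom M i p -> {for p, continuous (mchart M i)};
  minv_continuous :
    forall i x, mimage i x -> {for x, continuous (minv M i)};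
  mat_dom : forall p, mdom M (mat M p) p;
  transition_smooth : forall i j (b : 'I_n),
    Cinf_on (moverlap i j) (fun x => transition i j x 0 b);
  m_hausdorff : hausdorff_space M;
  m_second_countable : @second_countable M }.

(* Smoothness on an open set W; the values of h outside W are irrelevant. *)
Definition smooth_on (W : set M) (h : M -> R) : Prop :=
  forall i, Cinf_on (mimage i `&` minv M i @^-1` W) (h \o minv M i).

Definition smooth_fun (h : M -> R) : Prop := smooth_on setT h.

(* Tensor fields are families of component functions, one for each chart,
   defined on the chart image and related by the tensor transformation laws.
   The index convention for a vector X is the row of its components X^a. *)
Definition vfield := mindex M -> 'rV[R]_n -> 'rV[R]_n.
Definition bilfield := mindex M -> 'rV[R]_n -> 'M[R]_n.

Record smooth_vfield (X : vfield) : Prop := SmoothVfield {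
  vfield_smooth : forall i (a : 'I_n),
    Cinf_on (mimage i) (fun x => X i x 0 a);
  vfield_transition : forall i j x, moverlap i j x ->
    X j (transition i j x) = 'D_(X i x) (transition i j) x }.

Record pseudo_riemannian (g : bilfield) : Prop := PseudoRiemannian {
  metric_smooth : forall i (a b : 'I_n),
    Cinf_on (mimage i) (fun x => g i x a b);
  metric_sym : forall i x, mimage i x -> (g i x)^T = g i x;
  metric_nondeg : forall i x, mimage i x -> g i x \in unitmx;
  metric_transition : forall i j x, moverlap i j x ->
    forall v w : 'rV[R]_n,
      v *m g i x *m w^T =
      'D_v (transition i j) x *m g j (transition i j x)
        *m ('D_w (transition i j) x)^T }.

(* The function X(h), computed at p in the chart [mat M p]; for a smooth
   vector field and a smooth h the value is the same in every chart at p. *)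
Definition vapp (X : vfield) (h : M -> R) : M -> R := fun p =>
  let i := mat M p in
  let x := mchart M i p in
  'D_(X i x) (h \o minv M i) x.

End Manifold.

Section Curvature.
Variables (R : realType) (n : nat).
Implicit Types (G : 'rV[R]_n -> 'M[R]_n) (Z : 'rV[R]_n -> 'rV[R]_n).

(* Gamma^c_{ab} of the Levi-Civita connection of G *)
Definition christoffel G (c a b : 'I_n) (x : 'rV[R]_n) : R :=
  2^-1 * \sum_d invmx (G x) c d *
    (partial a (fun y => G y b d) x + partial b (fun y => G y a d) x
     - partial d (fun y => G y a b) x).

(* d-th component of
   nabla_a nabla_b e_c - nabla_b nabla_a e_c, where e_c is the c-th
   coordinate vector field *)
Definition riemann G (d c a b : 'I_n) (x : 'rV[R]_n) : R :=
  partial a (christoffel G d b c) x - partial b (christoffel G d a c) x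
  + \sum_e (christoffel G d a e x * christoffel G e b c x
            - christoffel G d b e x * christoffel G e a c x).

(* Ric(Y, V) = tr (X |-> R(X, Y) V), positive on round spheres *)
Definition ricci G (x : 'rV[R]_n) : 'M[R]_n :=
  \matrix_(b, c) \sum_a riemann G a c a b x.

Definition scalar_curvature G (x : 'rV[R]_n) : R :=
  \tr (invmx (G x) *m ricci G x).

Definition lie_metric Z G (x : 'rV[R]_n) : 'M[R]_n :=
  \matrix_(a, b) \sum_c
    (Z x 0 c * partial c (fun y => G y a b) x
     + G x c b * partial a (fun y => Z y 0 c) x
     + G x a c * partial b (fun y => Z y 0 c) x).

End Curvature.

Section Product.
Variables (R : realType) (n1 n2 : nat) (M1 : charted R n1) (M2 : charted R n2).

Definition prod_charted : charted R (n1 + n2) :=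
  @Charted R (n1 + n2) (M1 * M2)%type (mindex M1 * mindex M2)%type
    (fun i => mdom M1 i.1 `*` mdom M2 i.2)
    (fun i p => row_mx (mchart M1 i.1 p.1) (mchart M2 i.2 p.2))
    (fun i x => (minv M1 i.1 (lsubmx x), minv M2 i.2 (rsubmx x)))
    (fun p => (mat M1 p.1, mat M2 p.2)).

Definition hlift (X : vfield M1) : vfield prod_charted :=
  fun i x => row_mx (X i.1 (lsubmx x)) 0.

Definition vlift (U : vfield M2) : vfield prod_charted :=
  fun i x => row_mx 0 (U i.2 (rsubmx x)).

Definition projectable (Z : vfield prod_charted) : Prop :=
  exists (Z1 : vfield M1) (Z2 : vfield M2),
    [/\ smooth_vfield Z1, smooth_vfield Z2 &
        forall i x, mimage i x -> Z i x = hlift Z1 i x + vlift Z2 i x].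

(* g1 + f^2 g2 *)
Definition twisted_metric (g1 : bilfield M1) (g2 : bilfield M2)
    (f : prod_charted -> R) : bilfield prod_charted :=
  fun i x => block_mx (g1 i.1 (lsubmx x)) 0
                      0 (f (minv prod_charted i x) ^+ 2 *: g2 i.2 (rsubmx x)).

End Product.

Section Lyra.
Variables (R : realType) (n : nat) (M : charted R n).

Definition lyra_metric (phi : M -> R) (g : bilfield M) : bilfield M :=
  fun i x => phi (minv M i x) ^+ 2 *: g i x.

Record almost_ricci_bourguignon (g : bilfield M) (Z : vfield M)
    (lam : M -> R) (rho : R) : Prop := AlmostRicciBourguignon {
  arb_vfield : smooth_vfield Z;
  arb_smooth : smooth_fun lam;
  arb_eq : forall i x, mimage i x ->
    ricci (g i) x + 2^-1 *: lie_metric (Z i) (g i) x =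
    (lam (minv M i x) + rho * scalar_curvature (g i) x) *: g i x }.

End Lyra.

(* Main.v *)
Require Import Defs.
From mathcomp Require Import all_boot all_order all_algebra.
From mathcomp Require Import all_classical all_reals all_analysis.
From mathcomp Require Import ring lra.

(* In a chart, the soliton metric is the block metric A(x1) + H(x1, x2) B(x2)
   with H = (phi f)^2, because phi depends on M1 only. Its Ricci component
   Ric(d_mu, d_m), with mu vertical and m horizontal, is
   (1 - n2) d_mu d_m ln(phi f). The metric has no such mixed component, and
   neither has its Lie derivative along a projectable field, so
   d_mu d_m ln(phi f) = 0. The mean value theorem turns this into
   K(y1, y2) - K(y1, z2) = K(z1, y2) - K(z1, z2) on coordinate boxes, first for
   K = ln(phi f) and then, as ln phi cancels, for K = k. This identity implies
   both claims: XU(k) differentiates a difference quotient in x2 that does not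
   depend on x1, and the identity propagates along connected products. *)

Set Implicit Arguments.
Unset Strict Implicit.
Unset Printing Implicit Defensive.

Import Order.TTheory GRing.Theory Num.Theory.
Import numFieldNormedType.Exports.

Local Open Scope classical_set_scope.
Local Open Scope ring_scope.

(** * Directional derivatives and the mean value theorem *)

Section Lines.
Variable R : realType.

(** Both conclusions depend only on the filter of difference quotients at 0. Only increments are
    compared, so [f] and [g] may live on different spaces and differ by a constant. *)
Lemma near_eq_line (V W : normedModType R) (f : V -> R) (g : W -> R) x v y w :
  (\forall t \near (0 : R), f (t *: v + x) - f x = g (t *: w + y) - g y) ->
  derivable f x v = derivable g y w /\ 'D_v f x = 'D_w g y.
Proof.
move=> fg; pose q (h : R -> R) c (t : R) := t^-1 *: (h t - c) : R.
suff E : q (fun t => f (t *: v + x)) (f x) @ 0^' =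
         q (fun t => g (t *: w + y)) (g y) @ 0^'.
  by split; [exact: (congr1 (fun F => cvg F) E)|exact: (congr1 (fun F => lim F) E)].
rewrite eqEsubset; split; apply/near_eq_cvg/cvg_within;
  by apply: filterS fg => t; rewrite /q => ->.
Qed.

Lemma eq_line (V W : normedModType R) (f : V -> R) (g : W -> R) x v y w :
  (forall t : R, f (t *: v + x) = g (t *: w + y)) ->
  derivable f x v = derivable g y w /\ 'D_v f x = 'D_w g y.
Proof.
move=> fg; apply: near_eq_line; apply: (@filterE _ (nbhs (0 : R))) => t.
by rewrite fg; have := fg 0; rewrite !scale0r !add0r => ->.
Qed.

Lemma derive_line (V : normedModType R) (f : V -> R) x v (t : R) :
  derivable f (t *: v + x) v = derivable (fun s : R => f (s *: v + x)) t 1 /\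
  'D_v f (t *: v + x) = 'D_1 (fun s : R => f (s *: v + x)) t.
Proof.
by apply: eq_line => h; rewrite [_%:A]mulr1 scalerDl addrA.
Qed.

End Lines.

Lemma is_derive_0_ball (R : realType) (h : R -> R) (c r a b : R) :
  (forall t, ball c r t -> is_derive t 1 h 0) ->
  ball c r a -> ball c r b -> h a = h b.
Proof.
move=> hd; wlog ab : a b / a <= b => [hw ha hb|ha hb].
  by case: (leP a b) => [|/ltW] ab; [|apply/esym]; apply: hw.
have hin t : t \in `[a, b] -> ball c r t.
  move: ha hb; rewrite /ball/= in_itv/= !ltr_norml => /andP[? ?] /andP[? ?].
  by move=> /andP[? ?]; lra.
have [||t _ /eqP] := @MVT_segment R h (cst 0) a b ab.
- by move=> t /subset_itv_oo_cc /hin /hd.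
- apply: derivable_within_continuous => t /hin /hd ht; exact: ex_derive.
- by rewrite mul0r subr_eq0 => /eqP.
Qed.

Section Balls.
Variable R : realType.

Lemma rV_ballP n (c y : 'rV[R]_n) (r : R) : 0 < r ->
  ball c r y <-> forall i, ball (c 0 i) r (y 0 i).
Proof.
by move=> r0; split=> [[_ h] i|h]; [|split=> // i j; rewrite ord1].
Qed.

(** Walk from [y] to [z] by changing one coordinate at a time: the path stays in the ball, which is
    a box for the sup norm, and the mean value theorem applies on each segment. *)
Lemma constant_on_ball n (g : 'rV[R]_n -> R) (c : 'rV[R]_n) (r : R) :
  (forall y, ball c r y -> forall a,
     derivable g y (delta_mx 0 a) /\ partial a g y = 0) ->
  forall y z, ball c r y -> ball c r z -> g y = g z.
Proof.
move=> hg y z hy hz.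
have r0 : 0 < r by case: hy.
move: (hy) (hz) => /(rV_ballP _ _ r0) hy' /(rV_ballP _ _ r0) hz'.
pose w (j : nat) : 'rV[R]_n := \row_i (if (i < j)%N then z 0 i else y 0 i).
suff hw j : (j <= n)%N -> g (w j) = g y.
  rewrite -(hw n (leqnn n)); congr g; apply/rowP => i.
  by rewrite mxE ltn_ord.
elim: j => [|j IH] jn; first by congr g; apply/rowP => i; rewrite mxE.
rewrite -IH ?(ltnW jn)//; pose a := Ordinal jn.
(* [w j] and [w j.+1] lie on the line through [w0] in direction [a], at parameters [y 0 a] and
   [z 0 a]. *)
pose w0 : 'rV[R]_n :=
  \row_i (if (i < j)%N then z 0 i else if i == a then 0 else y 0 i).
have wE (t : R) i : (t *: delta_mx 0 a + w0) 0 i =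
    if (i < j)%N then z 0 i else if i == a then t else y 0 i.
  rewrite !mxE eqxx/=; case: eqVneq => [->|ia] /=.
    by rewrite ltnn mulr1 addr0.
  by rewrite mulr0 add0r.
have -> : w j = y 0 a *: delta_mx 0 a + w0.
  by apply/rowP => i; rewrite wE mxE; case: ifP => // _; case: eqVneq => [->|].
have -> : w j.+1 = z 0 a *: delta_mx 0 a + w0.
  apply/rowP => i; rewrite wE mxE ltnS leq_eqVlt -[_ == a]/(val i == j).
  by case: eqVneq => [ia|//]; rewrite ia ltnn /=; congr (z 0 _); apply/val_inj.
apply: (@is_derive_0_ball R (fun t => g (t *: delta_mx 0 a + w0)) (c 0 a) r) => //.
move=> t ht; have [|d0 d1] := hg (t *: delta_mx 0 a + w0) _ a.
  apply/rV_ballP => // i; rewrite wE; case: ifP => // _.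
  by case: eqVneq => [->|].
have [d2 d3] := derive_line g w0 (delta_mx 0 a) t.
by apply: DeriveDef; rewrite -?d2 -?d3.
Qed.

End Balls.

Section Slices.
Variables (R : realType) (n1 n2 : nat).
Implicit Type h : 'rV[R]_(n1 + n2) -> R.

Lemma row_mx_delta_l (a : 'I_n1) :
  row_mx (delta_mx 0 a) 0 = delta_mx 0 (lshift n2 a) :> 'rV[R]_(n1 + n2).
Proof.
apply/rowP => j; case: (split_ordP j) => k ->.
  by rewrite row_mxEl !mxE eq_lshift.
by rewrite row_mxEr !mxE eq_rlshift.
Qed.

Lemma row_mx_delta_r (b : 'I_n2) :
  row_mx 0 (delta_mx 0 b) = delta_mx 0 (rshift n1 b) :> 'rV[R]_(n1 + n2).
Proof.
apply/rowP => j; case: (split_ordP j) => k ->.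
  by rewrite row_mxEl !mxE eq_lrshift.
by rewrite row_mxEr !mxE eq_rshift.
Qed.

Lemma scale_row_mx_add (t : R) (u1 x1 : 'rV[R]_n1) (u2 x2 : 'rV[R]_n2) :
  t *: row_mx u1 u2 + row_mx x1 x2 = row_mx (t *: u1 + x1) (t *: u2 + x2).
Proof. by rewrite scale_row_mx add_row_mx. Qed.

Lemma slice_l h x1 x2 (a : 'I_n1) :
  derivable (fun y => h (row_mx y x2)) x1 (delta_mx 0 a) =
    derivable h (row_mx x1 x2) (delta_mx 0 (lshift n2 a)) /\
  partial a (fun y => h (row_mx y x2)) x1 = partial (lshift n2 a) h (row_mx x1 x2).
Proof.
apply: eq_line => t.
by rewrite -row_mx_delta_l scale_row_mx_add scaler0 add0r.
Qed.

Lemma slice_r h x1 x2 (b : 'I_n2) :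
  derivable (fun y => h (row_mx x1 y)) x2 (delta_mx 0 b) =
    derivable h (row_mx x1 x2) (delta_mx 0 (rshift n1 b)) /\
  partial b (fun y => h (row_mx x1 y)) x2 = partial (rshift n1 b) h (row_mx x1 x2).
Proof.
apply: eq_line => t.
by rewrite -row_mx_delta_r scale_row_mx_add scaler0 add0r.
Qed.

Lemma ball_row_mx (c1 y1 : 'rV[R]_n1) (c2 y2 : 'rV[R]_n2) (r : R) :
  ball (row_mx c1 c2) r (row_mx y1 y2) <-> ball c1 r y1 /\ ball c2 r y2.
Proof.
split=> [[r0 h]|[[r0 h1] [_ h2]]].
  split; split=> // i j.
    by have := h i (lshift _ j); rewrite !row_mxEl.
  by have := h i (rshift _ j); rewrite !row_mxEr.
split=> // i j; case: (split_ordP j) => k ->.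
  by rewrite !row_mxEl.
by rewrite !row_mxEr.
Qed.

(** Apply [constant_on_ball] twice: in the second block to the partial derivatives of [h] along the
    first, then in the first block to the difference of the slices at [y2] and [z2]. *)
Lemma mixed_partial0_rectangle h (c1 : 'rV[R]_n1) (c2 : 'rV[R]_n2) (r : R) :
  (forall y, ball (row_mx c1 c2) r y -> forall (a : 'I_n1) (b : 'I_n2),
     [/\ derivable h y (delta_mx 0 (lshift n2 a)),
         derivable (partial (lshift n2 a) h) y (delta_mx 0 (rshift n1 b)) &
         partial (rshift n1 b) (partial (lshift n2 a) h) y = 0]) ->
  forall y1 z1 y2 z2, ball c1 r y1 -> ball c1 r z1 ->
    ball c2 r y2 -> ball c2 r z2 ->
    h (row_mx y1 y2) - h (row_mx y1 z2) = h (row_mx z1 y2) - h (row_mx z1 z2).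
Proof.
move=> hh y1 z1 y2 z2 hy1 hz1 hy2 hz2.
have partial_eq x1 a : ball c1 r x1 ->
    partial (lshift n2 a) h (row_mx x1 y2) = partial (lshift n2 a) h (row_mx x1 z2).
  move=> hx1; apply: (@constant_on_ball R n2
    (fun x2 => partial (lshift n2 a) h (row_mx x1 x2)) c2 r) => // x2 hx2 b.
  have [-> ->] := slice_r (partial (lshift n2 a) h) x1 x2 b.
  by have [|? ? ?] := hh (row_mx x1 x2) _ a b; first exact/ball_row_mx.
(* The hypothesis yields derivability of [h] only for a pair of indices, so an index of the second
   block has to exist. *)
have [n20|n20] := posnP n2.
  have -> : y2 = z2 by apply/rowP => -[j jn]; exfalso; move: jn; rewrite n20.
  by rewrite !subrr.
apply: (@constant_on_ball R n1
  ((fun x1 => h (row_mx x1 y2)) - (fun x1 => h (row_mx x1 z2))) c1 r) => // x1 hx1 a.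
have d x2 : ball c2 r x2 ->
    derivable (fun x => h (row_mx x x2)) x1 (delta_mx 0 a).
  move=> hx2; have [-> _] := slice_l h x1 x2 a.
  by have [|? ? ?] := hh (row_mx x1 x2) _ a (Ordinal n20); first exact/ball_row_mx.
split; first by apply: derivableB; apply: d.
rewrite /partial deriveB; [|exact: d|exact: d].
have [_ p1] := slice_l h x1 y2 a; have [_ p2] := slice_l h x1 z2 a.
by rewrite -!/(partial _ _ _) p1 p2 partial_eq// subrr.
Qed.

End Slices.

(** * Functions of class C^k *)

Section Ck.
Variables (R : realType) (n : nat).
Implicit Types (A B : set 'rV[R]_n) (f g : 'rV[R]_n -> R).

Lemma Ck_on_continuous k A f x : Ck_on k A f -> A x -> {for x, continuous f}.
Proof. by case: k => [|k] [+ _] => /[apply]. Qed.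

Lemma Ck_onS k A f : Ck_on k.+1 A f -> Ck_on k A f.
Proof.
elim: k f => [|k IH] f [fc fd]; first by [].
by split=> // a; have [da ca] := fd a; split=> //; apply: IH.
Qed.

Lemma sub_Ck_on k A B f : A `<=` B -> Ck_on k B f -> Ck_on k A f.
Proof.
move=> AB; elim: k f => [|k IH] f [fc fd]; split=> //.
- by move=> x /AB /fc.
- by move=> x /AB /fc.
- by move=> a; have [da ca] := fd a; split=> [x /AB /da|]; last exact: IH.
Qed.

Lemma open_eq_near A f g x : open A -> {in A, f =1 g} -> A x ->
  \forall y \near x, f y = g y.
Proof.
move=> Ao fg Ax; have : nbhs x A by apply: open_nbhs_nbhs.
by apply: filterS => y Ay; apply: fg; rewrite inE.
Qed.

(** Openness makes equality on [A] an equality near each point of [A]. The rules below use this to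
    replace a partial derivative by its formula, which holds on [A] only. *)
Lemma eq_Ck_on k A f g : open A -> {in A, f =1 g} -> Ck_on k A f -> Ck_on k A g.
Proof.
move=> Ao; elim: k f g => [|k IH] f g fg [fc fd].
  split=> // x Ax; have fgx : f x = g x by apply: fg; rewrite inE.
  move: (fc x Ax); rewrite /prop_for /continuous_at fgx; apply: cvg_trans.
  exact: (near_eq_cvg (open_eq_near Ao fg Ax)).
have fgn x : A x -> \forall y \near x, f y = g y by exact: open_eq_near.
split=> [x Ax|a].
  have fgx : f x = g x by apply: fg; rewrite inE.
  move: (fc x Ax); rewrite /prop_for /continuous_at fgx; apply: cvg_trans.
  exact: (near_eq_cvg (fgn x Ax)).
have [da ca] := fd a; split=> [x Ax|].
  by apply: (near_eq_derivable (fgn x Ax)); apply: da.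
apply: IH ca => x /[!inE] Ax; apply: near_eq_derive; exact: fgn.
Qed.

Lemma Ck_onD k A f g : open A -> Ck_on k A f -> Ck_on k A g -> Ck_on k A (f + g).
Proof.
move=> Ao; elim: k f g => [|k IH] f g [fc fd] [gc gd].
  by split=> // x Ax; apply: continuousD; [apply: fc|apply: gc].
split=> [x Ax|a]; first by apply: continuousD; [apply: fc|apply: gc].
have [dfa cfa] := fd a; have [dga cga] := gd a.
split=> [x Ax|]; first by apply: derivableD; [apply: dfa|apply: dga].
apply: (eq_Ck_on Ao _ (IH _ _ cfa cga)) => x /[!inE] Ax.
by rewrite /partial deriveD//; [apply: dfa|apply: dga].
Qed.

Lemma Ck_onM k A f g : open A -> Ck_on k A f -> Ck_on k A g -> Ck_on k A (f * g).
Proof.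
move=> Ao; elim: k f g => [|k IH] f g Cf Cg.
  by split=> // x Ax; apply: continuousM; [apply: Cf.1|apply: Cg.1].
split=> [x Ax|a]; first by apply: continuousM; [apply: Cf.1|apply: Cg.1].
have [dfa cfa] := Cf.2 a; have [dga cga] := Cg.2 a.
split=> [x Ax|]; first by apply: derivableM; [apply: dfa|apply: dga].
apply: (eq_Ck_on Ao _ (Ck_onD Ao (IH _ _ (Ck_onS Cf) cga)
                                 (IH _ _ (Ck_onS Cg) cfa))) => x /[!inE] Ax.
by rewrite /partial deriveM//; [apply: dfa|apply: dga].
Qed.

Lemma Ck_on_cst k A (c : R) : Ck_on k A (cst c).
Proof.
elim: k c => [|k IH] c; split=> //.
- by move=> x _; apply: cst_continuous.
- by move=> x _; apply: cst_continuous.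
- move=> a; split=> [x _|]; first exact: derivable_cst.
  rewrite (_ : partial a _ = cst 0)//.
  by apply/funext => x; rewrite /partial derive_cst.
Qed.

(** The derivative [- f^-1 * f^-1 * f'] contains the inverse itself, which the induction hypothesis
    controls at the lower order. *)
Lemma Ck_onV k A f : open A -> (forall x, A x -> f x != 0) ->
  Ck_on k A f -> Ck_on k A (fun x => (f x)^-1).
Proof.
move=> Ao f0; elim: k => [|k IH] Cf.
  by split=> // x Ax; apply: continuousV; [apply: f0|apply: Cf.1].
split=> [x Ax|a]; first by apply: continuousV; [apply: f0|apply: Cf.1].
have [dfa cfa] := Cf.2 a; have CV := IH (Ck_onS Cf).
split=> [x Ax|]; first by apply: derivableV; [apply: f0|apply: dfa].
apply: (eq_Ck_on Ao _ (Ck_onM Ao (Ck_on_cst k A (-1))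
   (Ck_onM Ao (Ck_onM Ao CV CV) cfa))) => x /[!inE] Ax.
rewrite /partial deriveV; [|exact: f0|exact: dfa].
by rewrite !fctE -exprVn expr2 mulN1r scaleNr.
Qed.

(** Along the line [s *: v + x] this is the one-variable chain rule at [s = 0]. *)
Lemma is_derive_ln_comp f x v : 0 < f x -> derivable f x v ->
  derivable (fun y => ln (f y)) x v /\
  'D_v (fun y => ln (f y)) x = (f x)^-1 * 'D_v f x.
Proof.
move=> f0 df; pose F (s : R) := f (s *: v + x).
have [+ +] := derive_line f x v 0.
have [+ +] := derive_line (fun y => ln (f y)) x v 0.
rewrite scale0r add0r => -> -> dE DE.
have F0 : F 0 = f x by rewrite /F scale0r add0r.
have dF : is_derive (0 : R) 1 F ('D_v f x) by apply: DeriveDef; rewrite -?dE -?DE.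
have dl : is_derive (F 0) 1 (@ln R) (f x)^-1 by rewrite F0; apply: is_derive1_ln.
by have [] := is_derive1_comp dl dF.
Qed.

(** A case distinction on [k] replaces an induction, since the derivative [f^-1 * f'] no longer
    contains [ln]. *)
Lemma Ck_on_ln k A f : open A -> (forall x, A x -> 0 < f x) ->
  Ck_on k A f -> Ck_on k A (fun x => ln (f x)).
Proof.
move=> Ao f0 Cf.
have lnc x : A x -> {for x, continuous (fun x => ln (f x))}.
  move=> Ax; apply: continuous_comp; first exact: Ck_on_continuous Cf Ax.
  by apply: continuous_ln; apply: f0.
case: k Cf => [|k] Cf; split=> // a; have [dfa cfa] := Cf.2 a.
split=> [x Ax|].
  by have [] := is_derive_ln_comp (f0 x Ax) (dfa x Ax).
have fn0 x : A x -> f x != 0 by move=> /f0 /lt0r_neq0.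
apply: (eq_Ck_on Ao _ (Ck_onM Ao (Ck_onV Ao fn0 (Ck_onS Cf)) cfa)) => x /[!inE] Ax.
by have [_] := is_derive_ln_comp (f0 x Ax) (dfa x Ax); rewrite /partial => ->.
Qed.

End Ck.

Section CkSlices.
Variables (R : realType) (n1 n2 : nat).
Implicit Type h : 'rV[R]_(n1 + n2) -> R.

Lemma row_mx_continuous_l (x2 : 'rV[R]_n2) :
  continuous (fun x1 : 'rV[R]_n1 => row_mx x1 x2).
Proof.
move=> x1 B /nbhs_ballP[e e0 eB]; apply: (filterS _ (nbhsx_ballx x1 e e0)) => y hy.
by apply: eB; apply/ball_row_mx; split=> //; apply: ballxx.
Qed.

Lemma row_mx_continuous_r (x1 : 'rV[R]_n1) :
  continuous (fun x2 : 'rV[R]_n2 => row_mx x1 x2).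
Proof.
move=> x2 B /nbhs_ballP[e e0 eB]; apply: (filterS _ (nbhsx_ballx x2 e e0)) => y hy.
by apply: eB; apply/ball_row_mx; split=> //; apply: ballxx.
Qed.

Lemma Ck_on_slice_l k (A : set 'rV[R]_(n1 + n2)) h (x2 : 'rV[R]_n2) :
  Ck_on k A h ->
  Ck_on k [set x1 | A (row_mx x1 x2)] (fun x1 => h (row_mx x1 x2)).
Proof.
have cs h' x1 : {for row_mx x1 x2, continuous h'} ->
    {for x1, continuous (fun y => h' (row_mx y x2))}.
  by move=> hc; apply: continuous_comp; [exact: row_mx_continuous_l|exact: hc].
elim: k h => [|k IH] h [hc hd]; first by split=> // x1 /hc /cs.
split=> [x1 /hc /cs//|a]; have [da ca] := hd (lshift n2 a).
split=> [x1 /da|]; first by have [-> _] := slice_l h x1 x2 a.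
rewrite (_ : partial a _ = fun x1 => partial (lshift n2 a) h (row_mx x1 x2)).
  exact: IH.
by apply/funext => x1; have [_] := slice_l h x1 x2 a.
Qed.

Lemma Ck_on_slice_r k (A : set 'rV[R]_(n1 + n2)) h (x1 : 'rV[R]_n1) :
  Ck_on k A h ->
  Ck_on k [set x2 | A (row_mx x1 x2)] (fun x2 => h (row_mx x1 x2)).
Proof.
have cs h' x2 : {for row_mx x1 x2, continuous h'} ->
    {for x2, continuous (fun y => h' (row_mx x1 y))}.
  by move=> hc; apply: continuous_comp; [exact: row_mx_continuous_r|exact: hc].
elim: k h => [|k IH] h [hc hd]; first by split=> // x2 /hc /cs.
split=> [x2 /hc /cs//|b]; have [db cb] := hd (rshift n1 b).
split=> [x2 /db|]; first by have [-> _] := slice_r h x1 x2 b.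
rewrite (_ : partial b _ = fun x2 => partial (rshift n1 b) h (row_mx x1 x2)).
  exact: IH.
by apply/funext => x2; have [_] := slice_r h x1 x2 b.
Qed.

End CkSlices.

(** * Curvature of a twisted block metric *)

Section ConstantLines.
Variables (R : realType) (V : normedModType R).
Implicit Types f : V -> R.

Lemma derive_cst_line f x v : (\forall t \near (0 : R), f (t *: v + x) = f x) ->
  'D_v f x = 0.
Proof.
move=> fx; rewrite -(derive_cst (0 : R) x v).
apply: (near_eq_line _).2; apply: filterS fx => t ->.
by rewrite !subrr.
Qed.

Lemma near_line (A : set V) x v : nbhs x A ->
  \forall t \near (0 : R), A (t *: v + x).
Proof.
move=> Ax; have cA : {for 0, continuous (fun t : R => t *: v + x)}.
  by apply: cvgD; [exact: scalel_continuous|exact: cvg_cst].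
by apply: (cA A); rewrite scale0r add0r.
Qed.

Lemma eq_derive_open (A : set V) f g x v : open A -> A x ->
  (forall y, A y -> f y = g y) -> 'D_v f x = 'D_v g x.
Proof.
move=> Ao Ax fg; apply: near_eq_derive.
have : nbhs x A by apply: open_nbhs_nbhs.
exact: filterS.
Qed.

End ConstantLines.

Section TwistedCurvature.
Variables (R : realType) (n1 n2 : nat).
Variables (A : 'rV[R]_n1 -> 'M[R]_n1) (B : 'rV[R]_n2 -> 'M[R]_n2).
Variables (H : 'rV[R]_(n1 + n2) -> R) (D : set 'rV[R]_(n1 + n2)).

(** In the application [A] is [g1] scaled by the square of [phi], a function of the first block
    because [phi] is one; [H] is the square of [phi * f], and [B] is [g2]. *)
Let G (y : 'rV[R]_(n1 + n2)) : 'M[R]_(n1 + n2) :=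
  block_mx (A (lsubmx y)) 0 0 (H y *: B (rsubmx y)).

Hypothesis D_open : open D.
Hypothesis A_unit : forall y, D y -> A (lsubmx y) \in unitmx.
Hypothesis B_unit : forall y, D y -> B (rsubmx y) \in unitmx.
Hypothesis A_sym : forall y, D y -> (A (lsubmx y))^T = A (lsubmx y).
Hypothesis B_sym : forall y, D y -> (B (rsubmx y))^T = B (rsubmx y).
Hypothesis H_neq0 : forall y, D y -> H y != 0.
Hypothesis H_derivable : forall y, D y -> forall a : 'I_n1,
  derivable H y (delta_mx 0 (lshift n2 a)).

Let GE := (block_mxEul, block_mxEur, block_mxEdl, block_mxEdr, mxE).

Let Gll a b y : G y (lshift n2 a) (lshift n2 b) = A (lsubmx y) a b.
Proof. by rewrite /G block_mxEul. Qed.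
Let Glr a b y : G y (lshift n2 a) (rshift n1 b) = 0.
Proof. by rewrite /G block_mxEur mxE. Qed.
Let Grl a b y : G y (rshift n1 a) (lshift n2 b) = 0.
Proof. by rewrite /G block_mxEdl mxE. Qed.
Let Grr a b y : G y (rshift n1 a) (rshift n1 b) = H y * B (rsubmx y) a b.
Proof. by rewrite /G block_mxEdr mxE. Qed.

Lemma partial_lsubmx_r (h : 'rV[R]_n1 -> R) (b : 'I_n2) x :
  partial (rshift n1 b) (fun y : 'rV[R]_(n1 + n2) => h (lsubmx y)) x = 0.
Proof.
apply: derive_cst_line; apply: (@filterE _ (nbhs (0 : R))) => t.
by rewrite linearP/= -row_mx_delta_r row_mxKl scaler0 add0r.
Qed.

Lemma partial_rsubmx_l (h : 'rV[R]_n2 -> R) (a : 'I_n1) x :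
  partial (lshift n2 a) (fun y : 'rV[R]_(n1 + n2) => h (rsubmx y)) x = 0.
Proof.
apply: derive_cst_line; apply: (@filterE _ (nbhs (0 : R))) => t.
by rewrite linearP/= -row_mx_delta_l row_mxKr scaler0 add0r.
Qed.

Lemma partial_lsubmx_l (h : 'rV[R]_n1 -> R) (a : 'I_n1) x :
  partial (lshift n2 a) (fun y : 'rV[R]_(n1 + n2) => h (lsubmx y)) x =
  partial a h (lsubmx x).
Proof.
apply: (eq_line _).2 => t.
by rewrite linearP/= -row_mx_delta_l row_mxKl.
Qed.

Lemma partial0 n (a : 'I_n) x : partial a (fun _ => 0 : R) x = 0.
Proof. exact: derive_cst. Qed.

Let dGll_r a b c x :
  partial (rshift n1 c) (fun y => G y (lshift n2 a) (lshift n2 b)) x = 0.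
Proof.
under eq_fun do rewrite Gll.
exact: (partial_lsubmx_r (fun z => A z a b)).
Qed.
Let dGll_l a b c x :
  partial (lshift n2 c) (fun y => G y (lshift n2 a) (lshift n2 b)) x =
  partial c (fun z => A z a b) (lsubmx x).
Proof.
under eq_fun do rewrite Gll.
exact: (partial_lsubmx_l (fun z => A z a b)).
Qed.
Let dGlr a b c x :
  partial c (fun y => G y (lshift n2 a) (rshift n1 b)) x = 0.
Proof. by under eq_fun do rewrite Glr; exact: partial0. Qed.
Let dGrl a b c x :
  partial c (fun y => G y (rshift n1 a) (lshift n2 b)) x = 0.
Proof. by under eq_fun do rewrite Grl; exact: partial0. Qed.
Let dGrr_l a b c x : D x ->
  partial (lshift n2 c) (fun y => G y (rshift n1 a) (rshift n1 b)) x =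
  partial (lshift n2 c) H x * B (rsubmx x) a b.
Proof.
move=> Dx; under eq_fun do rewrite Grr.
(* Along a horizontal line [B (rsubmx y) a b] keeps its value at [x], so the derivative is that of a
   constant multiple of [H]. *)
rewrite -[X in _ = _ * X]/((fun _ => B (rsubmx x) a b) x).
rewrite /partial mulrC -deriveMl; last exact: H_derivable.
apply: (eq_line _).2 => t /=.
rewrite mulrC; congr (B _ a b * _).
by rewrite linearP/= -row_mx_delta_l row_mxKr scaler0 add0r.
Qed.

Let invG x : D x -> invmx (G x) =
  block_mx (invmx (A (lsubmx x))) 0 0 ((H x)^-1 *: invmx (B (rsubmx x))).
Proof.
move=> Dx; have HB : H x *: B (rsubmx x) \in unitmx.
  by rewrite unitmxZ ?unitfE ?H_neq0 ?B_unit.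
rewrite /G invmx_block_diag ?block_diag_mx_unit ?A_unit//.
by rewrite invmxZ// unitmxZ// unitfE H_neq0.
Qed.

Let G_sym c a b x : D x -> partial c (fun y => G y a b) x =
  partial c (fun y => G y b a) x.
Proof.
move=> Dx; apply: (eq_derive_open _ D_open Dx) => y Dy.
have -> : G y b a = (G y)^T a b by rewrite [RHS]mxE.
rewrite /G tr_block_mx !trmx0 linearZ/=.
by rewrite A_sym ?B_sym.
Qed.

Lemma twisted_christoffel_sym c a b x : D x ->
  christoffel G c a b x = christoffel G c b a x.
Proof.
move=> Dx; rewrite /christoffel; congr (_ * _); apply: eq_bigr => d _.
by rewrite [in RHS](addrC (partial b _ _)) (G_sym d a b Dx).
Qed.

(** The inverse of [G] is block diagonal, so here and below only the summands with [d] in the block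
    of the upper index survive. *)
Lemma twisted_christoffel_lll c a b x : D x ->
  christoffel G (lshift n2 c) (lshift n2 a) (lshift n2 b) x =
  christoffel A c a b (lsubmx x).
Proof.
move=> Dx; rewrite /christoffel big_split_ord/= invG//.
rewrite [X in _ + X]big1 ?addr0 => [|d _]; last by rewrite !GE mul0r.
by congr (_ * _); apply: eq_bigr => d _; rewrite block_mxEul !dGll_l.
Qed.

(** The mixed entries of [G] vanish, and [A] does not vary along the second block. *)
Lemma twisted_christoffel_lrl c b a x : D x ->
  christoffel G (lshift n2 c) (rshift n1 b) (lshift n2 a) x = 0.
Proof.
move=> Dx; rewrite /christoffel big_split_ord/= invG//.
rewrite [X in _ + X]big1 ?addr0 => [|d _]; last by rewrite !GE mul0r.
rewrite big1 ?mulr0// => d _.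
by rewrite dGll_r !dGrl addr0 subrr mulr0.
Qed.

(** Geometrically, the leaves on which the second block is constant are totally geodesic. *)
Lemma twisted_christoffel_rll c a b x : D x ->
  christoffel G (rshift n1 c) (lshift n2 a) (lshift n2 b) x = 0.
Proof.
move=> Dx; rewrite /christoffel big_split_ord/= invG//.
rewrite big1 ?add0r => [|d _]; last by rewrite !GE mul0r.
rewrite big1 ?mulr0// => d _.
by rewrite dGll_r !dGlr addr0 subrr mulr0.
Qed.

(* d_a (ln f) when H = f ^ 2 *)
Definition half_log_partial (a : 'I_n1) x : R :=
  2^-1 * ((H x)^-1 * partial (lshift n2 a) H x).

(** Contracting the inverse of [B] with the factor [B] in the horizontal derivative of [H * B]
    leaves a Kronecker delta; the factors from [H] form half its logarithmic derivative. *)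
Lemma twisted_christoffel_rrl c b a x : D x ->
  christoffel G (rshift n1 c) (rshift n1 b) (lshift n2 a) x =
  (c == b)%:R * half_log_partial a x.
Proof.
move=> Dx; rewrite /christoffel big_split_ord/= invG//.
rewrite big1 ?add0r => [|d _]; last by rewrite !GE mul0r.
rewrite /half_log_partial mulrCA; congr (_ * _).
have -> : (c == b)%:R = (invmx (B (rsubmx x)) *m B (rsubmx x)) c b.
  by rewrite mulVmx ?B_unit// mxE.
rewrite mxE big_distrl/=; apply: eq_bigr => d _.
rewrite dGlr dGrl dGrr_l// block_mxEdr mxE add0r subr0.
have -> : B (rsubmx x) b d = B (rsubmx x) d b by rewrite -[in LHS]B_sym// mxE.
by ring.
Qed.

(* With the vertical index first, only d_mu d_m occurs, so neither the symmetry
   of second derivatives nor second derivatives of A and B are needed. *)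
Lemma twisted_ricci_mixed (mu : 'I_n2) (m : 'I_n1) x : D x ->
  ricci G x (rshift n1 mu) (lshift n2 m) =
  (1 - n2%:R) * partial (rshift n1 mu) (half_log_partial m) x.
Proof.
(* Horizontal [a] contribute nothing: Gamma^a_{mu m} vanishes, Gamma^a_{a m} depends on the first
   block only, and every quadratic term has a vanishing factor. *)
move=> Dx; rewrite mxE big_split_ord/= big1 ?add0r => [|a _]; last first.
  rewrite /riemann.
  rewrite [X in X - _](_ : _ = 0); last first.
    rewrite -[RHS](partial0 (lshift n2 a) x).
    by apply: (eq_derive_open _ D_open Dx) => y Dy; exact: twisted_christoffel_lrl.
  rewrite [X in _ - X](_ : _ = 0); last first.
    rewrite -[RHS](partial_lsubmx_r (christoffel A a a m) mu x).
    by apply: (eq_derive_open _ D_open Dx) => y Dy; exact: twisted_christoffel_lll.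
  rewrite subrr add0r big_split_ord/= !big1 ?addr0// => e _.
    rewrite twisted_christoffel_rll// (twisted_christoffel_sym _ _ (rshift _ _))//.
    by rewrite twisted_christoffel_lrl// mul0r mulr0 subrr.
  by rewrite !twisted_christoffel_lrl// mul0r mulr0 subrr.
pose P := partial (rshift n1 mu) (half_log_partial m) x.
rewrite -/P.
(* For vertical [a], the term with the delta is d_a Gamma^a_{mu m} and the other one is d_mu
   Gamma^a_{a m}; the quadratic terms cancel. *)
transitivity (\sum_(a < n2) ((a == mu)%:R * P - P)).
  apply: eq_bigr => a _; rewrite /riemann.
  rewrite [X in X - _](_ : _ = (a == mu)%:R * P); last first.
    transitivity (partial (rshift n1 a)
        (fun y => (a == mu)%:R * half_log_partial m y) x).
      by apply: (eq_derive_open _ D_open Dx) => y Dy; exact: twisted_christoffel_rrl.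
    have [->|_] := eqVneq a mu; first by under eq_fun do rewrite mul1r; rewrite mul1r.
    by under eq_fun do rewrite mul0r; rewrite mul0r partial0.
  rewrite [X in _ - X + _](_ : _ = P); last first.
    apply: (eq_derive_open _ D_open Dx) => y Dy.
    by rewrite twisted_christoffel_rrl// eqxx mul1r.
  rewrite big_split_ord/= [X in _ + (X + _)]big1 ?add0r => [|e _]; last first.
    by rewrite !twisted_christoffel_lrl// !mulr0 subrr.
  rewrite sumrB.
  (* The two sums reduce to [e = mu] and [e = a]; the products left contain Gamma^a_{a mu} and
     Gamma^a_{mu a}, equal by symmetry. *)
  rewrite (bigD1 mu)//= big1 ?addr0 => [|e emu]; last first.
    by rewrite twisted_christoffel_rrl// (negPf emu) mul0r mulr0.
  rewrite [X in _ + (_ - X)](bigD1 a)//= big1 ?addr0 => [|e ea]; last first.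
    by rewrite twisted_christoffel_rrl// (negPf ea) mul0r mulr0.
  rewrite !twisted_christoffel_rrl// !eqxx (twisted_christoffel_sym _ (rshift n1 mu))//.
  by rewrite subrr addr0.
rewrite sumrB sumr_const card_ord (bigD1 mu)//= eqxx big1 ?addr0 => [|a amu]; last first.
  by rewrite (negPf amu) mul0r.
by rewrite mulrBl mul1r mulr_natl.
Qed.

(** [G] pairs [c] with [m] only for horizontal [c], where the component of [Z] does not vary along
    [mu]; it pairs [mu] with [c] only for vertical [c], where the component does not vary along
    [m]. *)
Lemma twisted_lie_metric_mixed (Z : 'rV[R]_(n1 + n2) -> 'rV[R]_(n1 + n2)) Z1 Z2
    (mu : 'I_n2) (m : 'I_n1) x :
  (forall y, D y -> Z y = row_mx (Z1 (lsubmx y)) (Z2 (rsubmx y))) -> D x ->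
  lie_metric Z G x (rshift n1 mu) (lshift n2 m) = 0.
Proof.
move=> ZE Dx; rewrite mxE big_split_ord/= !big1 ?addr0// => c _.
  rewrite dGrl mulr0 add0r Grl mul0r add0r.
  rewrite [partial _ _ _](_ : _ = 0) ?mulr0//.
  rewrite -[RHS](partial_rsubmx_l (fun z => Z2 z 0 c) m x).
  by apply: (eq_derive_open _ D_open Dx) => y Dy; rewrite ZE// row_mxEr.
rewrite dGrl mulr0 add0r Grl mul0r addr0.
rewrite [partial _ _ _](_ : _ = 0) ?mulr0//.
rewrite -[RHS](partial_lsubmx_r (fun z => Z1 z 0 c) mu x).
by apply: (eq_derive_open _ D_open Dx) => y Dy; rewrite ZE// row_mxEl.
Qed.

End TwistedCurvature.

(** * Product manifolds *)

(** [P] cuts out a relatively clopen part of [W]. The open witness is the interior of the set where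
    [W] forces [P]; the closed one is the complement of the interior of the set where [W] forces its
    negation. *)
Lemma connected_locally_invariant (T : topologicalType) (W : set T) (P : T -> Prop) :
  connected W ->
  (forall x, W x -> \forall y \near x, W y -> (P x <-> P y)) ->
  forall x y, W x -> W y -> P x -> P y.
Proof.
move=> Wc Ploc x y Wx Wy Px; suff WP : W `&` P = W by move: Wy; rewrite -WP => -[].
apply: Wc; first by exists x.
- exists (interior [set z | W z -> P z]); first exact: open_interior.
  apply/seteqP; split=> z [Wz Pz]; split=> //.
    by apply: filterS (Ploc z Wz) => u uP Wu; apply/uP.
  by have := nbhs_singleton Pz; apply.
- exists (~` interior [set z | W z -> ~ P z]).
    by apply: open_closedC; exact: open_interior.
  apply/seteqP; split=> z [Wz Pz]; split=> //.
    by move=> nP; exact: (nbhs_singleton nP).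
  apply: contrapT => nPz; apply: Pz.
  by apply: filterS (Ploc z Wz) => u uP Wu /(uP Wu).
Qed.

Section ProductCharts.
Variables (R : realType) (n1 n2 : nat) (M1 : charted R n1) (M2 : charted R n2).

Lemma mimage_prodP (i : mindex (prod_charted M1 M2)) x :
  mimage i x <-> mimage i.1 (lsubmx x) /\ mimage i.2 (rsubmx x).
Proof.
split=> [[[p1 p2] [/= d1 d2] <-]|[[p1 d1 e1] [p2 d2 e2]]].
  by rewrite row_mxKl row_mxKr; split; [exists p1|exists p2].
by exists (p1, p2) => //=; rewrite e1 e2 hsubmxK.
Qed.

Lemma lsubmx_continuous : continuous (@lsubmx R 1 n1 n2).
Proof.
move=> x B /nbhs_ballP[e e0 eB]; apply: (filterS _ (nbhsx_ballx x e e0)) => y.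
by rewrite -{1}[x]hsubmxK -{1}[y]hsubmxK => /ball_row_mx[? _]; apply: eB.
Qed.

Lemma rsubmx_continuous : continuous (@rsubmx R 1 n1 n2).
Proof.
move=> x B /nbhs_ballP[e e0 eB]; apply: (filterS _ (nbhsx_ballx x e e0)) => y.
by rewrite -{1}[x]hsubmxK -{1}[y]hsubmxK => /ball_row_mx[_ ?]; apply: eB.
Qed.

Lemma mimage_prod_open (i : mindex (prod_charted M1 M2)) :
  smooth_manifold M1 -> smooth_manifold M2 -> open (mimage i).
Proof.
move=> hM1 hM2.
rewrite (_ : mimage i = (lsubmx @^-1` mimage i.1) `&` (rsubmx @^-1` mimage i.2)).
  apply: openI; apply: open_comp; do ?exact: mimage_open.
    by move=> x _; exact: lsubmx_continuous.
  by move=> x _; exact: rsubmx_continuous.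
by apply/seteqP; split=> x /mimage_prodP.
Qed.

Lemma smooth_funE (h : prod_charted M1 M2 -> R) i :
  smooth_fun h -> Cinf_on (mimage i) (h \o minv _ i).
Proof.
by move=> hs k; apply: sub_Ck_on (hs i k) => x.
Qed.

End ProductCharts.

(** * Functions that split additively on coordinate boxes *)

Section Separable.
Variables (R : realType) (n1 n2 : nat) (M1 : charted R n1) (M2 : charted R n2).
Hypotheses (hM1 : smooth_manifold M1) (hM2 : smooth_manifold M2).

(** On a box this says that [k] is a sum of a function of each factor; the rectangle identity
    expresses it without choosing the summands. *)
Definition locally_separable (k : M1 * M2 -> R) : Prop :=
  forall i1 i2 c1 c2, @mimage _ _ M1 i1 c1 -> @mimage _ _ M2 i2 c2 ->
  exists2 r : R, 0 < r & forall y1 z1 y2 z2,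
    ball c1 r y1 -> ball c1 r z1 -> ball c2 r y2 -> ball c2 r z2 ->
    k (minv M1 i1 y1, minv M2 i2 y2) - k (minv M1 i1 y1, minv M2 i2 z2) =
    k (minv M1 i1 z1, minv M2 i2 y2) - k (minv M1 i1 z1, minv M2 i2 z2).

Variable k : M1 * M2 -> R.
Hypothesis hk : locally_separable k.

Lemma mchart_mimage n (M : charted R n) i p : mdom M i p -> mimage i (mchart M i p).
Proof. by exists p. Qed.

(** Small vertical increments of [k] do not depend on the first component near [p], so
    [vapp (vlift U) k] is constant along a short horizontal line. *)
Lemma vapp_hlift_vlift_separable (X : vfield M1) (U : vfield M2)
    (p : prod_charted M1 M2) :
  vapp (hlift X) (vapp (vlift U) (k : prod_charted M1 M2 -> R)) p = 0.
Proof.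
case: p => p1 p2; rewrite {1}/vapp /hlift /= row_mxKl.
have d1 := mat_dom hM1 p1; have d2 := mat_dom hM2 p2.
set c1 := mchart _ _ p1; set c2 := mchart _ _ p2.
have [r r0 hr] := hk (mchart_mimage d1) (mchart_mimage d2).
have e1 : minv M1 (mat M1 p1) c1 = p1 by rewrite mchartK.
have e2 : minv M2 (mat M2 p2) c2 = p2 by rewrite mchartK.
(* [vapp] uses at (q1, p2) a chart that jumps with q1, but the vertical
   derivative does not see the chart of the first factor. *)
suff vapp_eq y1 : ball c1 r y1 ->
    vapp (vlift U) (k : prod_charted M1 M2 -> R) (minv M1 (mat M1 p1) y1, p2) =
    vapp (vlift U) (k : prod_charted M1 M2 -> R) (p1, p2).
  apply: derive_cst_line.
  have := near_line (X (mat M1 p1) c1) (nbhsx_ballx c1 r r0).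
  apply: filterS => t ht /=.
  rewrite scale_row_mx_add scaler0 add0r !row_mxKl !row_mxKr e1 e2.
  exact: vapp_eq.
move=> hy1; set q1 := minv M1 _ y1.
rewrite /vapp /vlift /= !row_mxKr -/c2.
(* The slices of [k] at [q1] and [p1] differ by a constant near [p2], so their increments agree. *)
apply: (near_eq_line _).2.
have := near_line (U (mat M2 p2) c2) (nbhsx_ballx c2 r r0).
apply: filterS => s hs /=.
rewrite !scale_row_mx_add !scaler0 !add0r !row_mxKl !row_mxKr.
rewrite !mchartK//; last exact: mat_dom.
have := hr _ _ _ _ hy1 (ballxx c1 r0) hs (ballxx c2 r0).
by rewrite e1 e2.
Qed.

Lemma nbhs_chart_ball n (M : charted R n) i p (r : R) : smooth_manifold M ->
  mdom M i p -> 0 < r ->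
  \forall q \near p, mdom M i q /\ ball (mchart M i p) r (mchart M i q).
Proof.
move=> hM dp r0; apply: filterI.
  by apply: open_nbhs_nbhs; split=> //; exact: mdom_open.
by apply: (mchart_continuous hM dp); exact: nbhsx_ballx.
Qed.

(** The chart-free form of [locally_separable], suited to gluing. *)
Lemma nbhs_separable (p1 : M1) (p2 : M2) : exists (N1 : set M1) (N2 : set M2),
  [/\ nbhs p1 N1, nbhs p2 N2 & forall y1 z1 y2 z2, N1 y1 -> N1 z1 ->
        N2 y2 -> N2 z2 -> k (y1, y2) - k (y1, z2) = k (z1, y2) - k (z1, z2)].
Proof.
have d1 := mat_dom hM1 p1; have d2 := mat_dom hM2 p2.
have [r r0 hr] := hk (mchart_mimage d1) (mchart_mimage d2).
pose N n (M : charted R n) (p : M) : set M :=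
  [set q | mdom M (mat M p) q /\ ball (mchart M (mat M p) p) r (mchart M (mat M p) q)].
exists (N _ M1 p1), (N _ M2 p2); split; [exact: (nbhs_chart_ball hM1 d1 r0)|
                     exact: (nbhs_chart_ball hM2 d2 r0)|].
move=> y1 z1 y2 z2 [dy1 by1] [dz1 bz1] [dy2 by2] [dz2 bz2].
by have := hr _ _ _ _ by1 bz1 by2 bz2; rewrite !mchartK.
Qed.

(** Connectedness of the product is used twice: at a fixed first component, to move from [q0] to
    [q], and then to move from [p0] to [p] with a locally constant difference. *)
Lemma connected_separable (W1 : set M1) (W2 : set M2) p0 q0 p q :
  connected (W1 `*` W2) -> W1 p0 -> W2 q0 -> W1 p -> W2 q ->
  k (p, q) - k (p, q0) = k (p0, q) - k (p0, q0).
Proof.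
move=> Wc Wp0 Wq0 Wp Wq.
have locally_const p' : W1 p' ->
    \forall x \near p', k (x, q) - k (x, q0) = k (p', q) - k (p', q0).
  (* [P] concerns germs at [p'], so the neighbourhood of [p'] may shrink as [w] moves; at height
     [q0] it is trivial. *)
  move=> Wp'; pose P (w : M1 * M2) :=
    \forall x \near p', k (x, w.2) - k (x, q0) = k (p', w.2) - k (p', q0).
  apply: (@connected_locally_invariant _ _ P Wc _ (p', q0) (p', q)) => //; last first.
    by apply: nearW => x; rewrite /= !subrr.
  move=> [w1 w2] _; have [N1 [N2 [hN1 hN2 hN]]] := nbhs_separable p' w2.
  have : \forall y \near (w1, w2), N2 y.2 by apply: cvg_snd.
  apply: filterS => -[v1 v2] /= hv2 _.
  have N1p' := nbhs_singleton hN1; have N2w2 := nbhs_singleton hN2.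
  (* The rectangle identity between the heights [w2] and [v2] transfers the equality in both
     directions. *)
  split; apply: filter_app; apply: filterS hN1 => x N1x /= E.
    by have := hN _ _ _ _ N1x N1p' hv2 N2w2; move: E; lra.
  by have := hN _ _ _ _ N1x N1p' hv2 N2w2; move: E; lra.
pose Q (w : M1 * M2) := k (w.1, q) - k (w.1, q0) = k (p0, q) - k (p0, q0).
apply: (@connected_locally_invariant _ _ Q Wc _ (p0, q) (p, q)) => //.
move=> [w1 w2] [/= Ww1 _].
have : \forall y \near (w1, w2), k (y.1, q) - k (y.1, q0) = k (w1, q) - k (w1, q0).
  have h := locally_const w1 Ww1; exact: (cvg_fst h).
by apply: filterS => -[v1 v2] /= E _; rewrite /Q /= E.
Qed.

End Separable.

(** * The soliton equation in a product chart *)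

Section Soliton.
Variables (R : realType) (n1 n2 : nat) (M1 : charted R n1) (M2 : charted R n2).
Hypotheses (hM1 : smooth_manifold M1) (hM2 : smooth_manifold M2).
Variables (g1 : bilfield M1) (g2 : bilfield M2).
Hypotheses (hg1 : pseudo_riemannian g1) (hg2 : pseudo_riemannian g2).
Variables (f phi : prod_charted M1 M2 -> R).
Hypotheses (hf : smooth_fun f) (hf0 : forall p, 0 < f p).
Hypotheses (hphi : smooth_fun phi) (hphi0 : forall p, 0 < phi p).
Variable sigma1 : M1 -> R.
Hypothesis hsigma : forall p : prod_charted M1 M2, ln (phi p) = sigma1 p.1.
Variables (Z : vfield (prod_charted M1 M2)) (lam : prod_charted M1 M2 -> R) (rho : R).
Hypothesis hsol : almost_ricci_bourguignon
  (lyra_metric phi (twisted_metric g1 g2 f)) Z lam rho.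
Hypothesis hproj : projectable Z.
Hypothesis hn2 : (1 < n2)%N.

Lemma Ck_on_ln_warping (h : prod_charted M1 M2 -> R) i k :
  smooth_fun h -> (forall p, 0 < h p) ->
  Ck_on k (mimage i) (fun x => ln (h (minv _ i x))).
Proof.
move=> hs h0; apply: (@Ck_on_ln _ _ _ _ (h \o minv _ i)).
- exact: mimage_prod_open.
- by move=> x _ /=.
- exact: smooth_funE.
Qed.

(** At a mixed entry of the soliton equation the Lie derivative and the right-hand side vanish,
    which leaves the Ricci term alone. *)
Lemma soliton_mixed_partial i (K := fun x => ln (phi (minv _ i x) * f (minv _ i x))) x
    (a : 'I_n1) (b : 'I_n2) : mimage i x ->
  [/\ derivable K x (delta_mx 0 (lshift n2 a)),
      derivable (partial (lshift n2 a) K) x (delta_mx 0 (rshift n1 b)) &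
      partial (rshift n1 b) (partial (lshift n2 a) K) x = 0].
Proof.
move=> ix; have Do : open (mimage i) by exact: mimage_prod_open.
pose w := (phi \o minv _ i) * (f \o minv _ i).
have w0 y : 0 < w y.
  by apply: mulr_gt0; [exact: hphi0|exact: hf0].
have Cw k : Ck_on k (mimage i) w by apply: Ck_onM => //; exact: smooth_funE.
have CK k : Ck_on k (mimage i) K by exact: (Ck_on_ln Do (fun y _ => w0 y) (Cw k)).
have [dK CdK] := (CK 2).2 (lshift n2 a); have [ddK _] := CdK.2 (rshift n1 b).
split; [exact: dK|exact: ddK|].
(* Written through [sigma1], the square of [phi] becomes a function of the first block alone. *)
pose A (y : 'rV[R]_n1) := expR (sigma1 (minv M1 i.1 y)) ^+ 2 *: g1 i.1 y.
pose H := w * w.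
have dw y c : mimage i y -> derivable w y (delta_mx 0 c).
  by move=> iy; apply: ((Cw 1).2 c).1.
have GE : lyra_metric phi (twisted_metric g1 g2 f) i =
    fun y => block_mx (A (lsubmx y)) 0 0 (H y *: g2 i.2 (rsubmx y)).
  apply/funext => y; rewrite /lyra_metric /twisted_metric scale_block_mx !scaler0.
  rewrite /A -(hsigma (minv _ i y)) lnK ?posrE// scalerA.
  by congr (block_mx _ _ _ (_ *: _)); rewrite /H /w !fctE /=; ring.
have [Z1 [Z2 [_ _ ZE]]] := hproj.
have im1 y : mimage i y -> mimage i.1 (lsubmx y) by move=> /mimage_prodP[].
have im2 y : mimage i y -> mimage i.2 (rsubmx y) by move=> /mimage_prodP[].
have H0 y : H y != 0 by rewrite mulf_neq0 ?lt0r_neq0.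
have AU y : mimage i y -> A (lsubmx y) \in unitmx.
  move=> /im1 iy; rewrite unitmxZ ?(metric_nondeg hg1)//.
  by rewrite unitfE expf_neq0// lt0r_neq0 ?expR_gt0.
have AS y : mimage i y -> (A (lsubmx y))^T = A (lsubmx y).
  by move=> /im1 iy; rewrite linearZ/= (Defs.metric_sym hg1).
have BU y : mimage i y -> g2 i.2 (rsubmx y) \in unitmx.
  by move=> /im2; exact: metric_nondeg.
have BS y : mimage i y -> (g2 i.2 (rsubmx y))^T = g2 i.2 (rsubmx y).
  by move=> /im2; exact: Defs.metric_sym.
have dH y : mimage i y -> forall c : 'I_n1, derivable H y (delta_mx 0 (lshift n2 c)).
  by move=> iy c; apply: derivableM; exact: dw.
(* [H] is the square of [w], so both sides are the logarithmic derivative of [w]. *)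
have hlK y : mimage i y -> half_log_partial H a y = partial (lshift n2 a) K y.
  move=> iy; have dwy := dw y (lshift n2 a) iy.
  have [_] := is_derive_ln_comp (w0 y) dwy.
  rewrite /half_log_partial /partial => ->; rewrite deriveM// /H.
  have := lt0r_neq0 (w0 y); rewrite !fctE => wn0.
  rewrite -mulr2n -[_ *: _]/(_ * _) -mulr_natl.
  by field.
have := arb_eq hsol ix; rewrite GE => /matrixP /(_ (rshift n1 b) (lshift n2 a)).
rewrite [in LHS]mxE [X in _ + X]mxE.
rewrite (@twisted_lie_metric_mixed _ _ _ _ _ _ _ Do (Z i) (Z1 i.1) (Z2 i.2))//; last first.
  by move=> y iy; rewrite ZE// /hlift /vlift add_row_mx addr0 add0r.
rewrite (twisted_ricci_mixed Do AU BU AS BS)// mulr0 addr0.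
rewrite mxE block_mxEdl mxE mulr0 => /eqP; rewrite mulf_eq0 => /orP[|/eqP <-].
  (* In this case the factor [1 - n2] would vanish, which [1 < n2] forbids. *)
  by rewrite subr_eq0 eq_sym pnatr_eq1 gtn_eqF.
apply/esym; apply: (eq_derive_open _ Do ix) => y iy; exact: hlK.
Qed.

Lemma soliton_locally_separable :
  locally_separable (fun p : M1 * M2 => ln (f p)).
Proof.
move=> i1 i2 c1 c2 h1 h2; pose i : mindex (prod_charted M1 M2) := (i1, i2).
have ic : mimage i (row_mx c1 c2).
  by apply/mimage_prodP; rewrite row_mxKl row_mxKr.
have : nbhs (row_mx c1 c2) (mimage i).
  by apply: open_nbhs_nbhs; split=> //; exact: mimage_prod_open.
move=> /nbhs_ballP[r r0 hr]; exists r => // y1 z1 y2 z2 hy1 hz1 hy2 hz2.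
have := mixed_partial0_rectangle
  (fun y hy a b => soliton_mixed_partial a b (hr y hy)) hy1 hz1 hy2 hz2.
(* [ln phi] becomes [sigma1] of the first component, equal at both ends of each vertical difference,
   and cancels. *)
rewrite /= !row_mxKl !row_mxKr !lnM ?posrE// !hsigma /=; lra.
Qed.

End Soliton.

Theorem theorem4p3 (R : realType) (n1 n2 : nat)
  (hn1 : (0 < n1)%N) (hn2 : (1 < n2)%N)
  (M1 : charted R n1) (M2 : charted R n2)
  (hM1 : smooth_manifold M1) (hM2 : smooth_manifold M2)
  (g1 : bilfield M1) (g2 : bilfield M2)
  (hg1 : pseudo_riemannian g1) (hg2 : pseudo_riemannian g2)
  (f phi : prod_charted M1 M2 -> R)
  (hf : smooth_fun f) (hf0 : forall p, 0 < f p)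
  (hphi : smooth_fun phi) (hphi0 : forall p, 0 < phi p)
  (hsigma : exists2 sigma1 : M1 -> R, smooth_fun sigma1 &
     forall p : prod_charted M1 M2, ln (phi p) = sigma1 p.1)
  (Z : vfield (prod_charted M1 M2))
  (lam : prod_charted M1 M2 -> R) (rho : R)
  (hsol : almost_ricci_bourguignon
            (lyra_metric phi (twisted_metric g1 g2 f)) Z lam rho)
  (hproj : projectable Z) :
  let k : prod_charted M1 M2 -> R := fun p => ln (f p) in
  (forall (X : vfield M1) (U : vfield M2),
     smooth_vfield X -> smooth_vfield U ->
     forall p : prod_charted M1 M2, vapp (hlift X) (vapp (vlift U) k) p = 0)
  /\
  (forall (W1 : set M1) (W2 : set M2),
     open W1 -> open W2 -> connected (W1 `*` W2) ->
     exists (k1 : M1 -> R) (k2 : M2 -> R),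
       [/\ smooth_on W1 k1, smooth_on W2 k2,
           forall p q, W1 p -> W2 q -> k (p, q) = k1 p + k2 q &
           forall p q, W1 p -> W2 q ->
             f (p, q) = expR (k1 p) * expR (k2 q)]).
Proof.
move=> k; have [sigma1 _ sigmaE] := hsigma.
have hk : @locally_separable _ _ _ M1 M2 k.
  exact: (soliton_locally_separable hM1 hM2 hg1 hg2 hf hf0 hphi hphi0 sigmaE
            hsol hproj hn2).
split=> [X U _ _ p|W1 W2 _ _ Wc].
  exact: (vapp_hlift_vlift_separable hM1 hM2 hk).
(* An empty product offers no base point, yet one factor may be nonempty, so the witnesses still
   have to be smooth; constants are. *)
have [[[p0 q0] [/= Wp0 Wq0]]|W0] := pselect (W1 `*` W2 !=set0); last first.
  exists (cst 0), (cst 0); split=> [i m|i m|p q Wp Wq|p q Wp Wq].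
  - exact: Ck_on_cst.
  - exact: Ck_on_cst.
  - by exfalso; apply: W0; exists (p, q).
  - by exfalso; apply: W0; exists (p, q).
(* The summands are the slices of [k] through [(p0, q0)]; the value there, counted in both, is
   subtracted once. *)
exists (fun p => k (p, q0)), (fun q => k (p0, q) - k (p0, q0)).
have kE p q : W1 p -> W2 q -> k (p, q) = k (p, q0) + (k (p0, q) - k (p0, q0)).
  move=> Wp Wq; have := connected_separable hM1 hM2 hk Wc Wp0 Wq0 Wp Wq; lra.
split=> //.
(* In the product chart pairing [i1] with the chart around [q0], the first summand is a slice of
   [ln f]. *)
- move=> i1 m; pose i : mindex (prod_charted M1 M2) := (i1, mat M2 q0).
  have dq0 := mat_dom hM2 q0.
  have := Ck_on_slice_l (mchart M2 i.2 q0) (Ck_on_ln_warping hM1 hM2 i m hf hf0).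
  have -> : (fun x => ln (f (minv _ i (row_mx x (mchart M2 i.2 q0))))) =
      (fun p => k (p, q0)) \o minv M1 i1.
    by apply/funext => x /=; rewrite row_mxKl row_mxKr mchartK.
  apply: sub_Ck_on => x [ix _]; apply/mimage_prodP.
  by rewrite row_mxKl row_mxKr; split=> //; exact: mchart_mimage.
- move=> i2 m; pose i : mindex (prod_charted M1 M2) := (mat M1 p0, i2).
  have dp0 := mat_dom hM1 p0.
  have := Ck_on_slice_r (mchart M1 i.1 p0)
    (Ck_onD (mimage_prod_open (i := i) hM1 hM2) (Ck_on_ln_warping hM1 hM2 i m hf hf0)
            (Ck_on_cst m _ (- k (p0, q0)))).
  have -> : (fun x => ((fun y => ln (f (minv _ i y))) + cst (- k (p0, q0)))
                        (row_mx (mchart M1 i.1 p0) x)) =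
      (fun q => k (p0, q) - k (p0, q0)) \o minv M2 i2.
    by apply/funext => x; rewrite fctE /= row_mxKl row_mxKr mchartK.
  apply: sub_Ck_on => x [ix _]; apply/mimage_prodP.
  by rewrite row_mxKl row_mxKr; split=> //; exact: mchart_mimage.
- by move=> p q Wp Wq; rewrite -expRD -kE// lnK// posrE.
Qed.
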